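(* Let $d\in\mathbb{N}$ and let $G\leq O(d)$ be a finite group. The following are equivalent: (a) $G$ acts freely on $S(\mathbb{R}^d)$. (b) There exists a bilipschitz polynomial map $S(\mathbb{R}^d)/G\to\mathbb{R}^n$ for some $n\in\mathbb{N}$. (c) There exists a bilipschitz polynomial map $S(\mathbb{R}^d)/G\to\mathbb{R}^{2d-1}$.
   Context: $O(d)$ is the group of orthogonal transformations of $\mathbb{R}^d$, and $S(\mathbb{R}^d)$ is the unit sphere in $\mathbb{R}^d$. $G$ acts freely on $S(\mathbb{R}^d)$ if $gx=x$ with $x\in S(\mathbb{R}^d)$, $g\in G$ implies $g=\operatorname{id}$. $S(\mathbb{R}^d)/G$ is the set of orbits $[x]=G\cdot x$, $x\in S(\mathbb{R}^d)$, with the metric $d([x],[y])=\min_{g\in G}\|gx-y\|$. A polynomial map $S(\mathbb{R}^d)/G\to\mathbb{R}^n$ is a map of the form $[x]\mapsto f(x)$, where $f\colon\mathbb{R}^d\to\mathbb{R}^n$ is a $G$-invariant map whose coordinate functions are polynomials. A map $h\colon X\to Y$ of metric spaces is bilipschitz if there exist constants $0<\alpha\leq\beta<\infty$ with $\alpha\, d_X(x,x')\leq d_Y(h(x),h(x'))\leq\beta\, d_X(x,x')$ for all $x,x'\in X$ (so on a one-point space the condition is vacuous). *)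

(* Defs.v *)
From HB Require Import structures.
From mathcomp Require Import all_boot all_order all_algebra finmap.
From mathcomp Require Import boolp classical_sets reals.
(* Not imported: the notations of mpoly clash with those of mathcomp-analysis. *)
From mathcomp Require mpoly.

Set Implicit Arguments.
Unset Strict Implicit.
Unset Printing Implicit Defensive.

Import Order.TTheory GRing.Theory Num.Theory.
Local Open Scope ring_scope.
Local Open Scope classical_set_scope.

Section Euclidean.
Variable R : realType.

(* The norm of ['cV[R]_n] in mathcomp-analysis is the sup norm. *)
Definition enorm n (x : 'cV[R]_n) : R := Num.sqrt (\sum_(i < n) x i 0 ^+ 2).

Definition edist n (x y : 'cV[R]_n) : R := enorm (x - y).

Definition usphere d : set 'cV[R]_d := [set x | enorm x = 1].

Definition orthogonal_mx d (g : 'M[R]_d) : Prop := g^T *m g = 1%:M.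

Lemma enorm_orthogonal d (g : 'M[R]_d) (x : 'cV[R]_d) :
  orthogonal_mx g -> enorm (g *m x) = enorm x.
Proof.
have E (y : 'cV[R]_d) : \sum_(i < d) y i 0 ^+ 2 = (y^T *m y) 0 0.
  by rewrite mxE; apply: eq_bigr => i _; rewrite mxE expr2.
by move=> hg; rewrite /enorm !E trmx_mul -mulmxA (mulmxA g^T) hg mul1mx.
Qed.

End Euclidean.
Arguments usphere : clear implicits.

(* A finite subgroup of O(d); finiteness is carried by the type of [G]. *)
Record orthogonal_group (R : realType) (d : nat) (G : {fset 'M[R]_d}) : Prop :=
  OrthogonalGroup {
    og1 : 1%:M \in G ;
    ogM : forall g h, g \in G -> h \in G -> g *m h \in G ;
    ogV : forall g, g \in G -> invmx g \in G ;
    og_orthogonal : forall g, g \in G -> orthogonal_mx g }.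

Definition acts_freely_on_sphere (R : realType) (d : nat)
    (G : {fset 'M[R]_d}) : Prop :=
  forall (g : 'M[R]_d) (x : 'cV[R]_d),
    g \in G -> usphere R d x -> g *m x = x -> g = 1%:M.

Section SphereQuotient.
Variables (R : realType) (d : nat) (G : {fset 'M[R]_d}).

Definition orbit (x : 'cV[R]_d) : {fset 'cV[R]_d} := [fset g *m x | g in G]%fset.

(* Used below as a type, through the coercion [set_type]. *)
Definition sphere_quot : set {fset 'cV[R]_d} := orbit @` usphere R d.

Definition orbit_class (x : usphere R d) : sphere_quot :=
  SigSub (mem_set (imageP orbit (set_mem (valP x)))).

Lemma orbit_class_surj (A : sphere_quot) : exists x, orbit_class x = A.
Proof.
have [x hx e] := set_mem (valP A).
by exists (SigSub (mem_set hx)); apply: val_inj.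
Qed.

Definition orbit_repr (A : sphere_quot) : usphere R d :=
  projT1 (cid (orbit_class_surj A)).

Lemma orbit_reprK (A : sphere_quot) : orbit_class (orbit_repr A) = A.
Proof. by rewrite /orbit_repr; case: cid. Qed.

Definition orbit_min_dist (x y : 'cV[R]_d) : R :=
  \big[Num.min/edist x y]_(g <- enum_fset G) edist (g *m x) y.

(* For a group [G], the initial value [edist x y] is the term of the identity,
   so [orbit_min_dist] is the minimum over [G]; the choice of representatives
   is irrelevant by [qdist_class]. *)
Definition qdist (A B : sphere_quot) : R :=
  orbit_min_dist (val (orbit_repr A)) (val (orbit_repr B)).

Hypothesis GG : orthogonal_group G.

Lemma orbit_min_distP (x y : 'cV[R]_d) :
  (exists2 g, g \in G & orbit_min_dist x y = edist (g *m x) y) /\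
  (forall g, g \in G -> orbit_min_dist x y <= edist (g *m x) y).
Proof.
split; last by move=> g gG; apply: ge_bigmin_seq.
rewrite /orbit_min_dist.
have : {subset enum_fset G <= G} by [].
elim: (enum_fset G) => [|g s IHs] sG.
  by rewrite big_nil; exists 1%:M; rewrite ?og1 ?mul1mx.
rewrite big_cons; case: leP => _; first by exists g; rewrite ?sG ?mem_head.
by apply: IHs => h hs; apply: sG; rewrite inE hs orbT.
Qed.

Lemma orbit_class_eq (x x' : usphere R d) :
  orbit_class x = orbit_class x' -> exists2 g, g \in G & val x = g *m val x'.
Proof.
move=> /(congr1 val) /= e.
have : val x \in orbit (val x).
  by apply/imfsetP; exists 1%:M; rewrite ?mul1mx //; apply: og1.
by rewrite e => /imfsetP[g gG ->]; exists g.
Qed.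

Lemma qdist_class (x y : usphere R d) :
  qdist (orbit_class x) (orbit_class y) = orbit_min_dist (val x) (val y).
Proof.
suff le (x1 y1 x2 y2 : usphere R d) : orbit_class x1 = orbit_class x2 ->
    orbit_class y1 = orbit_class y2 ->
    orbit_min_dist (val x1) (val y1) <= orbit_min_dist (val x2) (val y2).
  by apply/eqP; rewrite /qdist eq_le !le ?orbit_reprK.
move=> /esym/orbit_class_eq[a aG ex] /orbit_class_eq[b bG ey].
have [[g gG ->] _] := orbit_min_distP (val x2) (val y2).
have [_ /(_ (b *m g *m a))] := orbit_min_distP (val x1) (val y1).
rewrite !ogM // => /(_ isT) /le_trans; apply.
rewrite ex ey /edist -!mulmxA -mulmxBr enorm_orthogonal //.
exact: og_orthogonal bG.
Qed.

End SphereQuotient.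

Definition bilipschitz (R : realType) (X Y : Type)
    (dX : X -> X -> R) (dY : Y -> Y -> R) (h : X -> Y) : Prop :=
  exists alpha beta : R, [/\ 0 < alpha, alpha <= beta &
    forall x x' : X, alpha * dX x x' <= dY (h x) (h x') <= beta * dX x x'].

Definition polynomial_coords (R : realType) (d n : nat)
    (f : 'cV[R]_d -> 'cV[R]_n) : Prop :=
  exists p : 'I_n -> mpoly.mpoly d R,
    forall (x : 'cV[R]_d) (i : 'I_n),
      f x i 0 = mpoly.meval (fun j => x j 0) (p i).

Definition invariant_map (R : realType) (d : nat) (T : Type)
    (G : {fset 'M[R]_d}) (f : 'cV[R]_d -> T) : Prop :=
  forall (g : 'M[R]_d) (x : 'cV[R]_d), g \in G -> f (g *m x) = f x.

Definition polynomial_quot_map (R : realType) (d : nat) (G : {fset 'M[R]_d})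
    (n : nat) (h : sphere_quot G -> 'cV[R]_n) : Prop :=
  exists f : 'cV[R]_d -> 'cV[R]_n,
    [/\ polynomial_coords f, invariant_map G f &
        forall x : usphere R d, h (orbit_class G x) = f (val x)].

Definition has_bilipschitz_polynomial_map (R : realType) (d : nat)
    (G : {fset 'M[R]_d}) (n : nat) : Prop :=
  exists h : sphere_quot G -> 'cV[R]_n,
    polynomial_quot_map h /\ bilipschitz (@qdist R d G) (@edist R n) h.

(* Main.v *)
(* If some [g <> 1] fixes a unit vector [x], then invariance kills the
   differential of a polynomial invariant [f] at [x] in the tangent direction
   [v = w - g w], so along the curve leaving [x] in direction [v] the value of
   [f] moves by O(t^2) while the orbit moves at distance of order t: no lower
   Lipschitz bound.

   Conversely, if the action is free, the G-averages of the polynomials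
   [<z - y, u> prod_(g <> 1) |z - g y|^2] and [prod_g |z - g y|^2] in [z]
   separate the orbit of [x] from that of [y] linearly in their distance (take
   [u = (x - y) / |x - y|] for nearby points). Expanding these kernels in the
   bounded parameters [y], [u] leaves finitely many invariants, which are the
   coordinates of a bilipschitz map to some R^n.

   To reduce n to 2d - 1, note that the secant vectors [f x - f y] depend on two
   points of the sphere S^(d-1): polynomials of degree at most K restricted to
   S^(d-1) x S^(d-1) span a space of dimension O(K^(2d-2)), so as soon as
   n > 2d - 2 the n ratios of n + 1 coordinates of the secant vectors are
   algebraically dependent. Projecting R^(n+1) to R^n along a vector at which
   this algebraic relation does not vanish preserves the lower Lipschitz
   bound, since the secant directions stay away from that vector. *)
Require Import Defs.
From mathcomp Require Import all_boot all_order all_algebra finmap.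
From mathcomp Require Import boolp reals ring lra.
(* Only the instances and coercions of mpoly: its notations clash with those of
   mathcomp-analysis. *)
From mathcomp Require Import (canonicals, coercions) mpoly.

Set Implicit Arguments.
Unset Strict Implicit.
Unset Printing Implicit Defensive.

Import Order.TTheory GRing.Theory Num.Theory.
Local Open Scope ring_scope.

(** * Polynomial functions *)

Section PolynomialFunctions.
Variables (R : realType) (d : nat).
Implicit Types p q : 'cV[R]_d -> R.

Definition polyfun p : Prop :=
  exists P : mpoly.mpoly d R, forall x, p x = mpoly.meval (fun j => x j 0) P.

Lemma polyfun_cst c : polyfun (fun=> c).
Proof. by exists (mpoly.mpolyC d c) => x; rewrite mpoly.mevalC. Qed.

Lemma polyfun_coord j : polyfun (fun x => x j 0).
Proof. by exists (mpoly.mpolyX R (mpoly.mnm1 j)) => x; rewrite mpoly.mevalXU. Qed.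

Lemma polyfunD p q : polyfun p -> polyfun q -> polyfun (fun x => p x + q x).
Proof. by move=> [P hP] [Q hQ]; exists (P + Q) => x; rewrite mpoly.mevalD hP hQ. Qed.

Lemma polyfunM p q : polyfun p -> polyfun q -> polyfun (fun x => p x * q x).
Proof. by move=> [P hP] [Q hQ]; exists (P * Q) => x; rewrite mpoly.mevalM hP hQ. Qed.

Lemma polyfunX p n : polyfun p -> polyfun (fun x => p x ^+ n).
Proof. by move=> [P hP]; exists (P ^+ n) => x; rewrite rmorphXn hP. Qed.

Lemma polyfun_sum (I : Type) (s : seq I) (F : I -> 'cV[R]_d -> R) :
  (forall i, polyfun (F i)) -> polyfun (fun x => \sum_(i <- s) F i x).
Proof.
move=> hF; elim: s => [|i s IHs].
  by under eq_fun do rewrite big_nil; apply: polyfun_cst.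
by under eq_fun do rewrite big_cons; apply: polyfunD.
Qed.

Lemma polyfun_prod (I : Type) (s : seq I) (F : I -> 'cV[R]_d -> R) :
  (forall i, polyfun (F i)) -> polyfun (fun x => \prod_(i <- s) F i x).
Proof.
move=> hF; elim: s => [|i s IHs].
  by under eq_fun do rewrite big_nil; apply: polyfun_cst.
by under eq_fun do rewrite big_cons; apply: polyfunM.
Qed.

(** Monomials are expanded into nested list products, so that closure under binary sums and products
    suffices. *)
Lemma polyfun_ind (Q : ('cV[R]_d -> R) -> Prop) :
  (forall c, Q (fun=> c)) -> (forall j, Q (fun x => x j 0)) ->
  (forall p q, Q p -> Q q -> Q (fun x => p x + q x)) ->
  (forall p q, Q p -> Q q -> Q (fun x => p x * q x)) ->
  forall p, polyfun p -> Q p.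
Proof.
move=> Qc Qx QD QM p [P hP].
have -> : p = fun x => \sum_(m <- mpoly.msupp P)
    mpoly.mcoeff m P * \prod_(i <- enum 'I_d) \prod_(k <- iota 0 (m i)) x i 0.
  apply/funext => x; rewrite hP mpoly.mevalE; apply: eq_bigr => m _.
  rewrite big_enum; congr (_ * _); apply: eq_bigr => i _.
  by rewrite big_const_seq count_predT size_iota -Monoid.iteropE.
elim: (mpoly.msupp P : seq _) => [|m s IHs].
  by under eq_fun do rewrite big_nil.
under eq_fun do rewrite big_cons.
apply: (QD) IHs; apply: (QM); first exact: Qc.
elim: (enum _) => [|i t IHt]; first by under eq_fun do rewrite big_nil.
under eq_fun do rewrite big_cons.
apply: (QM) IHt; elim: (iota _ _) => [|k r IHr].
  by under eq_fun do rewrite big_nil.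
by under eq_fun do rewrite big_cons; apply: QM.
Qed.

End PolynomialFunctions.

Lemma polyfun_comp (R : realType) d e (f : 'cV[R]_d -> 'cV[R]_e) p :
  (forall i, polyfun (fun x => f x i 0)) -> polyfun p ->
  polyfun (fun x => p (f x)).
Proof.
move=> hf; elim/polyfun_ind => [c|j|q r hq hr|q r hq hr].
- exact: polyfun_cst.
- exact: hf.
- exact: polyfunD.
- exact: polyfunM.
Qed.

Lemma polyfun_mulmx (R : realType) d (g : 'M[R]_d) (i : 'I_d) :
  polyfun (fun x : 'cV[R]_d => (g *m x) i 0).
Proof.
under eq_fun do rewrite mxE.
apply: polyfun_sum => j; apply: polyfunM; first exact: polyfun_cst.
exact: polyfun_coord.
Qed.

Lemma polyfun_lipschitz (R : realType) d (p : 'cV[R]_d -> R) (B : R) :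
  polyfun p -> exists2 L : R, 0 <= L & forall (x y : 'cV[R]_d) (s : R),
    (forall j, `|x j 0| <= B) -> (forall j, `|y j 0| <= B) ->
    (forall j, `|x j 0 - y j 0| <= s) -> 0 <= s -> `|p x - p y| <= L * s.
Proof.
(* The bound [C] of [p] on the box is carried along for the product case. *)
move=> hp; suff [L [C [L0 C0 hL _]]] : exists L C : R,
    [/\ 0 <= L, 0 <= C,
     forall (x y : 'cV[R]_d) (s : R),
      (forall j, `|x j 0| <= B) -> (forall j, `|y j 0| <= B) ->
      (forall j, `|x j 0 - y j 0| <= s) -> 0 <= s -> `|p x - p y| <= L * s &
     forall x : 'cV[R]_d, (forall j, `|x j 0| <= B) -> `|p x| <= C].
  by exists L.
elim/polyfun_ind: hp => [c|j|q r|q r].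
- by exists 0, `|c|; split => // x y s _ _ _ _; rewrite subrr normr0 mul0r.
- exists 1, `|B|; split => // [x y s _ _ h _|x h]; first by rewrite mul1r.
  exact: le_trans (h j) (ler_norm _).
- move=> [L1 [C1 [L10 C10 h1 k1]]] [L2 [C2 [L20 C20 h2 k2]]].
  exists (L1 + L2), (C1 + C2); split; rewrite ?addr_ge0 //; last first.
    by move=> x hx; rewrite (le_trans (ler_normD _ _)) // lerD ?k1 ?k2.
  move=> x y s hx hy hs s0.
  rewrite opprD addrACA mulrDl (le_trans (ler_normD _ _)) // lerD //.
    exact: h1.
  exact: h2.
- move=> [L1 [C1 [L10 C10 h1 k1]]] [L2 [C2 [L20 C20 h2 k2]]].
  exists (L1 * C2 + C1 * L2), (C1 * C2).
  split; rewrite ?addr_ge0 ?mulr_ge0 //; last first.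
    by move=> x hx; rewrite normrM ler_pM ?k1 ?k2.
  move=> x y s hx hy hs s0.
  have -> : q x * r x - q y * r y = (q x - q y) * r x + q y * (r x - r y).
    by ring.
  rewrite (le_trans (ler_normD _ _)) // !normrM mulrDl lerD //.
    by rewrite mulrAC ler_pM ?h1 ?k2.
  by rewrite -mulrA ler_pM ?h2 ?k1.
Qed.

(** * Polynomials on a product of two spheres *)

Section SphereMonomials.
Variables (R : realType) (d : nat).
Implicit Types (z : bool -> 'cV[R]_d.+1) (phi psi : (bool -> 'cV[R]_d.+1) -> R).

Definition on_spheres z : Prop := forall s, \sum_i z s i 0 ^+ 2 = 1.

Definition monom (b : bool * 'I_d -> nat) (e : bool -> nat) z : R :=
  (\prod_s z s ord0 0 ^+ e s) * \prod_q z q.1 (lift ord0 q.2) 0 ^+ b q.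

(* The relation [\sum_i z s i 0 ^+ 2 = 1] eliminates squares of the coordinate
   [ord0], so boolean exponents suffice for it; eliminating one raises the
   degree in the others by at most 2, hence the bound [2 * K]. *)
Definition in_span K phi : Prop :=
  exists c : {ffun bool * 'I_d -> 'I_(2 * K).+1} * {ffun bool -> bool} -> R,
  forall z, on_spheres z ->
    phi z = \sum_j c j * monom (fun q => j.1 q) (fun s => j.2 s) z.

Lemma in_span_ext K phi psi : (forall z, on_spheres z -> phi z = psi z) ->
  in_span K psi -> in_span K phi.
Proof. by move=> e [c hc]; exists c => z hz; rewrite e ?hc. Qed.

Lemma in_spanD K phi psi : in_span K phi -> in_span K psi ->
  in_span K (fun z => phi z + psi z).
Proof.
move=> [c hc] [c' hc']; exists (fun j => c j + c' j) => z hz.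
by rewrite hc // hc' // -big_split; apply: eq_bigr => j _; rewrite mulrDl.
Qed.

Lemma in_spanZ K a phi : in_span K phi -> in_span K (fun z => a * phi z).
Proof.
move=> [c hc]; exists (fun j => a * c j) => z hz.
by rewrite hc // mulr_sumr; apply: eq_bigr => j _; rewrite mulrA.
Qed.

Lemma in_span_sum K (I : Type) (s : seq I) (F : I -> (bool -> 'cV[R]_d.+1) -> R) :
  (forall i, in_span K (F i)) -> in_span K (fun z => \sum_(i <- s) F i z).
Proof.
move=> hF; elim: s => [|i s IHs].
  exists (fun=> 0) => z _; rewrite big_nil big1 // => j _; exact: mul0r.
by apply: in_span_ext (in_spanD (hF i) IHs) => z _; rewrite big_cons.
Qed.

Lemma in_span_monom K b (e : bool -> bool) : (forall q, (b q <= 2 * K)%N) ->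
  in_span K (monom b (fun s => e s)).
Proof.
move=> hb; pose j0 : {ffun bool * 'I_d -> 'I_(2 * K).+1} * {ffun bool -> bool} :=
  ([ffun q => inord (b q)], [ffun s => e s]).
exists (fun j => (j == j0)%:R) => z _.
rewrite (bigD1 j0) //= eqxx mul1r big1 ?addr0; last first.
  by move=> j /negPf ->; rewrite mul0r.
rewrite /monom; congr (_ * _); apply: eq_bigr => i _; rewrite ffunE //.
by rewrite inordK // ltnS.
Qed.

Lemma monomM b b' e e' z :
  monom b e z * monom b' e' z = monom (fun q => b q + b' q)%N (fun s => e s + e' s)%N z.
Proof.
rewrite /monom mulrACA -!big_split; congr (_ * _).
  by apply: eq_bigr => s _; rewrite exprD.
by apply: eq_bigr => q _; rewrite exprD.
Qed.

Lemma prod_expr_delta (I : finType) (x : I -> R) i0 n :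
  \prod_i x i ^+ (n * (i == i0)) = x i0 ^+ n.
Proof.
rewrite (bigD1 i0) //= eqxx muln1 big1 ?mulr1 // => i /negPf ->.
by rewrite muln0.
Qed.

Lemma monom_lift q n z :
  monom (fun r => n * (r == q))%N (fun=> 0%N) z = z q.1 (lift ord0 q.2) 0 ^+ n.
Proof. by rewrite /monom big1 // mul1r prod_expr_delta. Qed.

Lemma monom_ord0 s n z :
  monom (fun=> 0%N) (fun t => n * (t == s))%N z = z s ord0 0 ^+ n.
Proof. by rewrite /monom mulrC big1 // mul1r prod_expr_delta. Qed.

(** The equation of the sphere is applied only here. *)
Lemma in_span_coord K s i phi : in_span K phi ->
  in_span K.+1 (fun z => z s i 0 * phi z).
Proof.
move=> [c hc].
apply: (@in_span_ext _ _ (fun z =>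
    \sum_j c j * (z s i 0 * monom (fun q => j.1 q) (fun s => j.2 s) z))).
  move=> z hz; rewrite hc // mulr_sumr.
  by apply: eq_bigr => j _; rewrite mulrCA.
apply: in_span_sum => -[b e] /=; apply: in_spanZ => {c hc phi}.
have hb q : (b q <= 2 * K)%N by rewrite -ltnS.
case: (unliftP ord0 i) => [i'|] ->.
  apply: (in_span_ext
    (psi := monom (fun q => 1 * (q == (s, i')) + b q)%N (fun t => e t))).
    by move=> z _; rewrite -[LHS]/(_ ^+ 1 * _) -(monom_lift (s, i')) monomM.
  apply: in_span_monom => q; rewrite mul1n mulnS.
  exact: leq_add (leq_trans (leq_b1 _) _) (hb q).
(* An exponent 0 of the coordinate [ord0] becomes 1; an exponent 1 would become 2, and the square is
   replaced by 1 minus the other squares. *)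
case es: (e s); last first.
  apply: (in_span_ext (psi := monom (fun q => b q) (fun t => (t == s) || e t))).
    move=> z _; rewrite -[LHS]/(_ ^+ 1 * _) -monom_ord0 monomM.
    congr (_ * _); apply: eq_bigr => t _; rewrite mul1n.
    by case: eqVneq => // ->; rewrite es.
  by apply: in_span_monom => q; rewrite (leq_trans (hb q)) // leq_mul2l leqnSn.
pose e0 t := (t != s) && e t.
apply: (in_span_ext (psi := fun z => monom (fun q => b q) (fun t => e0 t) z +
   (-1) * \sum_i' monom (fun q => 2 * (q == (s, i')) + b q)%N (fun t => e0 t) z)).
  move=> z hz; have -> : monom (fun q => b q) (fun t => e t) z =
      z s ord0 0 * monom (fun q => b q) (fun t => e0 t) z.
    rewrite -[RHS]/(_ ^+ 1 * _) -monom_ord0 monomM.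
    congr (_ * _); apply: eq_bigr => t _; rewrite mul1n /e0.
    by case: eqVneq => // ->; rewrite es.
  under eq_bigr => i' _ do
    rewrite -[X in monom _ X]/(fun t => 0 + e0 t)%N -monomM monom_lift.
  rewrite /= -mulr_suml mulN1r -[X in X - _]mul1r -mulrBl mulrA -expr2.
  by rewrite -(hz s) big_ord_recl addrK.
apply: in_spanD; last apply: in_spanZ; last apply: in_span_sum => i';
  apply: in_span_monom => q.
  by rewrite (leq_trans (hb q)) // leq_mul2l leqnSn.
by rewrite mulnS leq_add // (leq_mul (leqnn 2) (leq_b1 _)).
Qed.

Lemma in_span_leq K K' phi : (K <= K')%N -> in_span K phi -> in_span K' phi.
Proof.
move=> le [c hc]; apply: (in_span_ext hc); apply: in_span_sum => -[b e].
apply: in_spanZ; apply: in_span_monom => q /=.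
by rewrite (@leq_trans (2 * K)) ?leq_mul2l // -ltnS.
Qed.

(** Degree is read off from multiplication, which shifts the spans by [e]; products then compose
    without multiplying two expansions. *)
Definition degree_le e phi : Prop :=
  forall K psi, in_span K psi -> in_span (K + e) (fun z => phi z * psi z).

Lemma degree_le_leq e e' phi : (e <= e')%N -> degree_le e phi -> degree_le e' phi.
Proof. by move=> le h K psi /h; apply: in_span_leq; rewrite leq_add2l. Qed.

Lemma degree_le_cst c : degree_le 0 (fun=> c).
Proof. by move=> K psi h; rewrite addn0; apply: in_spanZ. Qed.

Lemma degree_leD e phi phi' : degree_le e phi -> degree_le e phi' ->
  degree_le e (fun z => phi z + phi' z).
Proof.
move=> h h' K psi hpsi; apply: in_span_ext (in_spanD (h _ _ hpsi) (h' _ _ hpsi)).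
by move=> z _; rewrite mulrDl.
Qed.

Lemma degree_leM e e' phi phi' : degree_le e phi -> degree_le e' phi' ->
  degree_le (e + e') (fun z => phi z * phi' z).
Proof.
move=> h h' K psi /h'/h; rewrite -addnA [(e' + e)%N]addnC; apply: in_span_ext.
by move=> z _; rewrite mulrA.
Qed.

Lemma degree_leX e phi n : degree_le e phi -> degree_le (e * n) (fun z => phi z ^+ n).
Proof.
move=> h; elim: n => [|n IHn]; first by rewrite muln0; apply: degree_le_cst.
by rewrite mulnS; under eq_fun do rewrite exprS; apply: degree_leM.
Qed.

Lemma degree_le_prod (I : Type) (r : seq I) (e : I -> nat)
    (F : I -> (bool -> 'cV[R]_d.+1) -> R) :
  (forall i, degree_le (e i) (F i)) ->
  degree_le (\sum_(i <- r) e i) (fun z => \prod_(i <- r) F i z).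
Proof.
move=> h; elim: r => [|i r IHr].
  rewrite big_nil; under eq_fun do rewrite big_nil; apply: degree_le_cst.
rewrite big_cons; under [X in degree_le _ X]eq_fun do rewrite big_cons.
exact: degree_leM.
Qed.

Lemma polyfun_degree_le p : polyfun p ->
  exists e, forall s, degree_le e (fun z => p (z s)).
Proof.
elim/polyfun_ind => [c|j|q r [e he] [e' he']|q r [e he] [e' he']].
- by exists 0%N => s; apply: degree_le_cst.
- by exists 1%N => s K psi; rewrite addn1; apply: in_span_coord.
- exists (maxn e e') => s; apply: degree_leD.
    by apply: degree_le_leq (he s); apply: leq_maxl.
  by apply: degree_le_leq (he' s); apply: leq_maxr.
- by exists (e + e')%N => s; apply: degree_leM.
Qed.

End SphereMonomials.

(* Exponent vectors in [{0..b-1}^n] are coded by their value [k < b ^ n] in base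
   [b]: Kronecker's substitution [y_i = T ^+ (b ^ i)] then turns the monomial of
   code [k] into [T ^+ k], and a nonzero polynomial into a nonzero one. *)
Definition digit b k i : nat := (k %/ b ^ i) %% b.

Lemma sum_digits b n k : (k < b ^ n)%N -> (\sum_(i < n) digit b k i * b ^ i = k)%N.
Proof.
elim: n k => [|n IHn] k; first by rewrite big_ord0; case: k.
rewrite expnS => lt; have b0 : (0 < b)%N by case: b lt {IHn}.
rewrite big_ord_recl /= {1}/digit expn0 divn1 muln1 [RHS](divn_eq k b) addnC.
congr (_ + _)%N; have ltq : (k %/ b < b ^ n)%N by rewrite ltn_divLR // mulnC.
rewrite -[X in (X * b)%N](IHn _ ltq) big_distrl; apply: eq_bigr => i _ /=.
by rewrite /digit /bump /= add1n expnS -divnMA -mulnA [(b ^ i * b)%N]mulnC.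
Qed.

(** A polynomial of degree [m < n] in [D] is eventually below [D ^ n]: here
    [a * (b.+1 * D) ^ m < D ^ m.+1] once [a * b.+1 ^ m < D]. *)
Lemma growth_gt a b m n : (m < n)%N -> exists D : nat,
  (a * (b * D.-1).+1 ^ m < D ^ n)%N /\ (0 < D)%N.
Proof.
move=> lt; exists (a * b.+1 ^ m).+1; split=> //.
set D := (a * b.+1 ^ m).+1; apply: (@leq_trans (D ^ m.+1)); last by rewrite leq_pexp2l.
rewrite expnS; apply: (@leq_ltn_trans (a * (b.+1 * D) ^ m)).
  rewrite leq_mul2l; apply/orP; right.
  have : ((b * D.-1).+1 <= b.+1 * D)%N.
    by rewrite /= mulSn addnC -addn1 leq_add // leq_mul2l leqnSn orbT.
  by case: (m) => // m'; rewrite leq_exp2r.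
by rewrite expnMn mulnA ltn_pmul2r ?expn_gt0.
Qed.

(** * Generic projections of secants *)

(** The coefficient matrix has more rows than columns, so its left kernel is nonzero. *)
Lemma dependent_families (R : realType) (X J : Type) (m : nat) (K : finType)
    (D : X -> Prop) (phi : 'I_m -> X -> R) (g : K -> X -> R) :
  (#|K| < m)%N ->
  (forall k, exists c : K -> R, forall z, D z -> phi k z = \sum_j c j * g j z) ->
  exists2 u : 'I_m -> R, exists k, u k != 0 &
    forall z, D z -> \sum_k u k * phi k z = 0.
Proof.
move=> ltm /choice[c hc]; pose M := \matrix_(k < m, j < #|K|) c k (enum_val j).
have /rowV0Pn[u /sub_kermxP uM u0] : kermx M != 0.
  rewrite kermx_eq0 /row_free; apply: contraL ltm => /eqP <-.
  by rewrite -leqNgt rank_leq_col.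
exists (fun k => u 0 k); first by case/rV0Pn: u0 => k; exists k.
move=> z Dz; under eq_bigr => k _ do rewrite hc // mulr_sumr.
rewrite exchange_big (reindex (@enum_val _ predT)) /=; last first.
  exact: onW_bij (enum_val_bij K).
rewrite big1 // => j _; under eq_bigr do rewrite mulrA.
rewrite -mulr_suml; have /(congr1 (fun N : 'rV_ _ => N 0 j)) := uM.
by rewrite !mxE; under eq_bigr do rewrite mxE; move->; rewrite mul0r.
Qed.

(** A dimension count: there are [b ^ n] monomials in the ratios, but with denominators cleared they
    lie in a space of dimension of order [b ^ (2 * d)]. *)
Lemma algebraic_dependence (R : realType) d n
    (F : 'I_n.+1 -> (bool -> 'cV[R]_d.+1) -> R) :
  (forall i, exists e, degree_le e (F i)) -> (2 * d < n)%N ->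
  exists b (u : 'I_(b ^ n) -> R), (exists k, u k != 0) /\
    forall z, on_spheres z -> F ord_max z != 0 ->
      \sum_k u k * \prod_(i < n)
        (F (lift ord_max i) z / F ord_max z) ^+ digit b k i = 0.
Proof.
move=> /choice[e0 he0] ltn; pose e := (\max_i e0 i)%N.
have {he0}hF i : degree_le e (F i) by apply: degree_le_leq (he0 i); apply: leq_bigmax.
(* The factor 4 counts the boolean exponents at the two points; [e * n * b.-1] bounds the degree of
   the cleared monomials. *)
have [b [ltb b0]] := growth_gt 4 (2 * (e * n)) ltn.
pose M := (n * b.-1)%N; pose deg k := (\sum_(i < n) digit b k i)%N.
have degM k : (deg k <= M)%N.
  have -> : M = (\sum_(i < n) b.-1)%N by rewrite sum_nat_const card_ord.
  by apply: leq_sum => i _; rewrite -ltnS prednK // ltn_mod.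
(* This is the monomial of code [k] in the ratios times [F ord_max z ^+ M], with the same [M] for
   all [k]. *)
pose phi (k : 'I_(b ^ n)) z := F ord_max z ^+ (M - deg k) *
  \prod_(i < n) F (lift ord_max i) z ^+ digit b k i.
have hphi k : in_span (e * M) (phi k).
  have : degree_le (e * (M - deg k) + \sum_(i < n) e * digit b k i) (phi k).
    apply: degree_leM; first exact: degree_leX.
    by apply: degree_le_prod => i; apply: degree_leX.
  rewrite -big_distrr -mulnDr subnK // => /(_ 0%N (fun=> 1)); rewrite add0n => h.
  apply: in_span_ext (h _) => [z _|]; first by rewrite mulr1.
  apply: in_span_ext (@in_span_monom R d _ (fun=> 0%N) (fun=> false) _) => //.
  by move=> z _; rewrite /monom !big1 // mulr1.
have [] := @dependent_families R _ unit _ _ (@on_spheres R d) phi _ _ hphi.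
  rewrite card_prod !card_ffun card_prod !card_ord !card_bool mulnC -!mulnA.
  by move: ltb; rewrite !mulnA.
move=> u u0 hu; exists b, u; split=> // z hz Fz; apply: (mulfI (expf_neq0 M Fz)).
rewrite mulr0 -[RHS](hu z hz) mulr_sumr; apply: eq_bigr => k _.
rewrite mulrCA; congr (_ * _); under eq_bigr do rewrite expr_div_n.
rewrite prodf_div -expr_sum -/(deg k) -{1}(subnK (degM k)) exprD -mulrA.
by rewrite [F ord_max z ^+ deg k * _]mulrC divfK // expf_neq0.
Qed.

Lemma exists_nonroot (R : realType) (C : {poly R}) :
  C != 0 -> exists T, C.[T] != 0.
Proof.
move=> C0; pose rs := [seq i%:R : R | i <- iota 0 (size C)].
have [/hasP[T _ hT]|/hasPn h] := boolP (has (fun T => C.[T] != 0) rs).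
  by exists T.
have : (size rs < size C)%N.
  apply: max_poly_roots C0 _ _.
    by apply/allP => T /h; rewrite negbK.
  by rewrite map_inj_uniq ?iota_uniq // => i j /eqP; rewrite eqr_nat => /eqP.
by rewrite size_map size_iota ltnn.
Qed.

(** The projection is along the vector with coordinates [a] and last coordinate 1. The relation [h]
    between the ratios of secant coordinates does not vanish at [a], so these ratios stay at
    distance at least [eta] from [a]. *)
Lemma secant_projection (R : realType) d n (p : 'I_n.+1 -> 'cV[R]_d.+1 -> R) :
  (forall i, polyfun (p i)) -> (2 * d < n)%N ->
  exists (a : 'I_n -> R) (c : R), 0 < c /\ forall x y : 'cV[R]_d.+1,
      \sum_i x i 0 ^+ 2 = 1 -> \sum_i y i 0 ^+ 2 = 1 -> forall s,
      (forall i, `|(p (lift ord_max i) x - a i * p ord_max x) -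
                   (p (lift ord_max i) y - a i * p ord_max y)| <= s) ->
      forall i, c * `|p i x - p i y| <= s.
Proof.
move=> hp ltn; pose F i (z : bool -> 'cV[R]_d.+1) := p i (z true) - p i (z false).
have hF i : exists e, degree_le e (F i).
  have [e he] := polyfun_degree_le (hp i); exists e; apply: degree_leD => //.
  under eq_fun do rewrite -mulN1r.
  by rewrite -[e]add0n; apply: degree_leM (he false); apply: degree_le_cst.
have [b [u [[k0 uk0] hu]]] := algebraic_dependence hF ltn.
pose C := \sum_k u k *: 'X^k.
have /exists_nonroot[T hT] : C != 0.
  apply: contraNneq uk0 => /(congr1 (fun P : {poly R} => P`_k0)).
  rewrite coef0 coef_sum (bigD1 k0) //= coefZ coefXn eqxx mulr1.
  rewrite big1 ?addr0 => [->//|k nk].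
  by rewrite coefZ coefXn eq_sym (inj_eq val_inj) (negPf nk) mulr0.
(* By expansion in base [b], the relation takes the value [C.[T]] at this point. *)
pose a := \col_(i < n) T ^+ (b ^ i).
pose h (y : 'cV[R]_n) := \sum_k u k * \prod_(i < n) y i 0 ^+ digit b k i.
have ha : h a != 0.
  suff -> : h a = C.[T] by [].
  rewrite horner_sum; apply: eq_bigr => k _; rewrite hornerZ hornerXn.
  congr (_ * _); rewrite -[in RHS](sum_digits (ltn_ord k)) expr_sum.
  by apply: eq_bigr => i _; rewrite mxE -exprM mulnC.
pose A := \sum_i `|a i 0|.
have hA i : `|a i 0| <= A by rewrite /A (bigD1 i) //= lerDl sumr_ge0.
have A0 : 0 <= A by apply: sumr_ge0.
have hpoly : polyfun h.
  apply: polyfun_sum => k; apply: polyfunM; first exact: polyfun_cst.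
  by apply: polyfun_prod => i; apply: polyfunX; apply: polyfun_coord.
have [L L0 hL] := polyfun_lipschitz (A + 1) hpoly.
(* Within distance 1 of [a] the Lipschitz constant [L] is valid, so [h] has no zero closer to [a]
   than [eta]. *)
pose eta := Num.min 1 (`|h a| / (L + 1)).
have eta0 : 0 < eta.
  by rewrite lt_min ltr01 divr_gt0 ?normr_gt0 // ltr_wpDl.
have h0 (y : 'cV[R]_n) s : h y = 0 -> 0 <= s ->
    (forall i, `|y i 0 - a i 0| <= s) -> eta <= s.
  move=> hy s0 hs; rewrite leNgt lt_min; apply/negP => /andP[s1].
  rewrite ltr_pdivlMr ?ltr_wpDl //; apply/negP; rewrite -leNgt.
  rewrite -normrN -sub0r -hy (@le_trans _ _ (L * s)) //; last first.
    by rewrite mulrC ler_wpM2l // lerDl.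
  apply: hL => // i; last by rewrite (le_trans (hA i)) // lerDl.
  rewrite -[y i 0](subrK (a i 0)) addrC (le_trans (ler_normD _ _)) // lerD //.
  exact: le_trans (hs i) (ltW s1).
exists (fun i => a i 0), (eta / (1 + A)); split.
  by rewrite divr_gt0 // ltr_pwDl.
move=> x y hx hy s hs; pose z (t : bool) := if t then x else y.
have hz : on_spheres z by case.
have {}hs i : `|F (lift ord_max i) z - a i 0 * F ord_max z| <= s.
  by have := hs i; congr (`|_| <= s); rewrite /F /=; ring.
have n0 : (0 < n)%N by apply: leq_ltn_trans ltn.
have s0 : 0 <= s := le_trans (normr_ge0 _) (hs (Ordinal n0)).
have hmax : eta * `|F ord_max z| <= s.
  have [->|w0] := eqVneq (F ord_max z) 0; first by rewrite normr0 mulr0.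
  rewrite -ler_pdivlMr ?normr_gt0 //.
  apply: (h0 (\col_i (F (lift ord_max i) z / F ord_max z))).
  - rewrite -[RHS](hu z hz w0); apply: eq_bigr => k _.
    by congr (_ * _); apply: eq_bigr => i _; rewrite mxE.
  - by rewrite divr_ge0.
  - move=> i; rewrite ler_pdivlMr ?normr_gt0 // -normrM mulrBl mxE divfK //.
have A1 : 0 < 1 + A by rewrite ltr_pwDl.
have eta1 : eta <= 1 by rewrite ge_min lexx.
move=> i; rewrite -[_ - _]/(F i z) mulrAC ler_pdivrMr //.
(* [hmax] settles the last coordinate. Any other one is [a j 0] times it plus an error of at most
   [s], whence the factor [1 + A]. *)
case: (unliftP ord_max i) => [j|] ->; last first.
  by rewrite (le_trans hmax) // ler_peMr // lerDl.
have -> : F (lift ord_max j) z =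
  (F (lift ord_max j) z - a j 0 * F ord_max z) + a j 0 * F ord_max z by rewrite subrK.
rewrite (le_trans (ler_wpM2l (ltW eta0) (ler_normD _ _))) // mulrDr [s * _]mulrDr mulr1.
rewrite lerD //; first by rewrite (le_trans (ler_wpM2l (ltW eta0) (hs j))) // ler_piMl.
by rewrite normrM mulrCA mulrC ler_pM // mulr_ge0 // ltW.
Qed.

(** * Invariants separating the orbits of a free action *)

Section SquaredNorm.
Variables (R : realType) (d : nat).
Implicit Types (x y : 'cV[R]_d) (g : 'M[R]_d).

Definition dot x y : R := \sum_i x i 0 * y i 0.
Definition sqn x : R := \sum_i x i 0 ^+ 2.

Lemma dotDl x x' y : dot (x + x') y = dot x y + dot x' y.
Proof. by rewrite -big_split; apply: eq_bigr => i _; rewrite mxE mulrDl. Qed.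

Lemma dotZl c x y : dot (c *: x) y = c * dot x y.
Proof. by rewrite mulr_sumr; apply: eq_bigr => i _; rewrite mxE mulrA. Qed.

Lemma dot0l y : dot 0 y = 0.
Proof. by apply: big1 => i _; rewrite mxE mul0r. Qed.

Lemma dotC x y : dot x y = dot y x.
Proof. by apply: eq_bigr => i _; rewrite mulrC. Qed.

Lemma dotNl x y : dot (- x) y = - dot x y.
Proof. by rewrite -scaleN1r dotZl mulN1r. Qed.

Lemma sqnE x : sqn x = dot x x.
Proof. by apply: eq_bigr => i _; rewrite expr2. Qed.

Lemma sqn_ge0 x : 0 <= sqn x.
Proof. by apply: sumr_ge0 => i _; apply: sqr_ge0. Qed.

Lemma enorm_ge0 x : 0 <= enorm x. Proof. exact: sqrtr_ge0. Qed.

Lemma sqr_enorm x : enorm x ^+ 2 = sqn x.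
Proof. by rewrite sqr_sqrtr // sqn_ge0. Qed.

Lemma sqnZ c x : sqn (c *: x) = c ^+ 2 * sqn x.
Proof. by rewrite !sqnE dotZl dotC dotZl mulrA expr2. Qed.

Lemma sqnN x : sqn (- x) = sqn x.
Proof. by rewrite -scaleN1r sqnZ sqrrN expr1n mul1r. Qed.

Lemma sqnD x y : sqn (x + y) = sqn x + 2 * dot x y + sqn y.
Proof. by rewrite !sqnE dotDl ![dot _ (x + y)]dotC !dotDl [dot y x]dotC; ring. Qed.

Lemma sqnD_le x y : sqn (x + y) <= 2 * sqn x + 2 * sqn y.
Proof.
have := sqn_ge0 (x - y); rewrite !sqnD sqnN [dot x (- y)]dotC dotNl dotC; lra.
Qed.

Lemma dot_le x y : `|dot x y| <= (sqn x + sqn y) / 2.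
Proof.
have := sqn_ge0 (x - y); have := sqn_ge0 (x + y).
by rewrite !sqnD sqnN [dot x (- y)]dotC dotNl [dot y x]dotC ler_norml; lra.
Qed.

Lemma sqn_eq0 x : (sqn x == 0) = (x == 0).
Proof.
rewrite psumr_eq0; last by move=> i _; apply: sqr_ge0.
apply/allP/eqP => [h|-> i _]; last by rewrite mxE expr0n eqxx.
apply/colP => i; rewrite mxE; apply/eqP.
by rewrite -sqrf_eq0; apply: (h i (mem_index_enum _)).
Qed.

Lemma sqn0 : sqn 0 = 0.
Proof. by apply/eqP; rewrite sqn_eq0. Qed.

Lemma coord_le_enorm x i : `|x i 0| <= enorm x.
Proof.
rewrite -sqrtr_sqr ler_sqrt ?sqn_ge0 // (bigD1 i) //= lerDl.
by apply: sumr_ge0 => j _; apply: sqr_ge0.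
Qed.

Lemma usphereE x : usphere R d x <-> sqn x = 1.
Proof.
rewrite /usphere /= -sqr_enorm; split=> [->|/eqP]; first exact: expr1n.
by rewrite sqrf_eq1 => /orP[/eqP //|/eqP e]; have := enorm_ge0 x; rewrite e; lra.
Qed.

Lemma sqn_orthogonal g x : orthogonal_mx g -> sqn (g *m x) = sqn x.
Proof. by move=> og; rewrite -!sqr_enorm enorm_orthogonal. Qed.

Lemma sqn_normalize x : x != 0 -> sqn ((enorm x)^-1 *: x) = 1.
Proof.
by rewrite -sqn_eq0 => x0; rewrite sqnZ exprVn sqr_enorm mulVf.
Qed.

Lemma sqn_mulmx_le g : exists2 C, 0 < C & forall x, sqn (g *m x) <= C * sqn x.
Proof.
pose b i := \sum_j `|g i j|; exists (1 + \sum_i b i ^+ 2) => [|x].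
  by rewrite ltr_pwDl // sumr_ge0 // => i _; apply: sqr_ge0.
apply: (@le_trans _ _ ((\sum_i b i ^+ 2) * sqn x)); last first.
  by rewrite ler_wpM2r ?sqn_ge0 // lerDr.
rewrite mulr_suml; apply: ler_sum => i _.
rewrite -sqr_enorm -exprMn -real_normK ?num_real // lerXn2r ?nnegrE ?normr_ge0 //.
  by rewrite mulr_ge0 ?enorm_ge0 // sumr_ge0.
rewrite mxE mulr_suml (le_trans (ler_norm_sum _ _ _)) //.
by apply: ler_sum => j _; rewrite normrM ler_wpM2l // coord_le_enorm.
Qed.

End SquaredNorm.

(** The minimum of the constants works. Over the elements of [G], this replaces a compactness
    argument. *)
Lemma uniform_pos (R : realType) (T : eqType) (s : seq T) (P : T -> R -> Prop) :
  (forall t c c', c' <= c -> P t c -> P t c') ->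
  (forall t, t \in s -> exists2 c, 0 < c & P t c) ->
  exists2 c, 0 < c & forall t, t \in s -> P t c.
Proof.
move=> mono; elim: s => [|t s IHs] h; first by exists 1.
have [c c0 hc] := h t (mem_head _ _).
have [|c' c'0 hc'] := IHs; first by move=> u us; apply: h; rewrite inE us orbT.
exists (Num.min c c'); first by rewrite lt_min c0.
move=> u; rewrite inE => /predU1P[->|us].
  by apply: mono hc; rewrite ge_min lexx.
by apply: mono (hc' _ us); rewrite ge_min lexx orbT.
Qed.

(** The bound 4 is the squared diameter of the unit sphere. Being at least 1, it may also be counted
    for the omitted factors. *)
Lemma prod_itv4 (R : realType) (T : eqType) (s : seq T) (P : pred T) (F : T -> R) :
  (forall t, t \in s -> 0 <= F t <= 4) ->
  0 <= \prod_(t <- s | P t) F t <= 4 ^+ size s.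
Proof.
elim: s => [|t s IHs] h; first by rewrite big_nil ler01 /=.
have /andP[h0 h4] := h t (mem_head _ _).
have [|p0 p4] := andP (IHs _); first by move=> u us; apply: h; rewrite inE us orbT.
rewrite big_cons exprS; case: (P t); first by rewrite mulr_ge0 ?ler_pM.
by rewrite p0 (le_trans p4) // ler_peMl ?exprn_ge0 //; lra.
Qed.

(** * Kernels of finite rank with bounded parameters *)

Section Kernels.
Variables (R : realType) (d : nat) (T : Type) (D : T -> Prop).
Implicit Types K : 'cV[R]_d -> T -> R.

Definition separated K : Prop :=
  exists (J : finType) (a : J -> 'cV[R]_d -> R) (b : J -> T -> R) (B : R),
  [/\ forall j, polyfun (a j), forall j t, D t -> `|b j t| <= B &
      forall z t, D t -> K z t = \sum_j a j z * b j t].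

Lemma separated_polyfun p : polyfun p -> separated (fun z _ => p z).
Proof.
move=> hp; exists unit, (fun=> p), (fun=> fun=> 1), 1.
by split=> // [_ t _|z t _]; rewrite ?normr1 // big_const card_unit /= addr0 mulr1.
Qed.

Lemma separated_bounded (b : T -> R) B : (forall t, D t -> `|b t| <= B) ->
  separated (fun _ t => b t).
Proof.
move=> hb; exists unit, (fun=> fun=> 1), (fun=> b), B.
split=> // [_|z t _]; first exact: polyfun_cst.
by rewrite big_const card_unit /= addr0 mul1r.
Qed.

Lemma separatedD K K' : separated K -> separated K' ->
  separated (fun z t => K z t + K' z t).
Proof.
move=> [J [a [b [B [ha hb hK]]]]] [J' [a' [b' [B' [ha' hb' hK']]]]].
exists (J + J')%type, (fun j => match j with inl j => a j | inr j => a' j end),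
  (fun j => match j with inl j => b j | inr j => b' j end), (Num.max B B').
split=> [[]|[] j t Dt|z t Dt] //; rewrite ?le_max ?hb ?hb' ?orbT //.
by rewrite big_sumType /= hK ?hK'.
Qed.

Lemma separatedM K K' : separated K -> separated K' ->
  separated (fun z t => K z t * K' z t).
Proof.
move=> [J [a [b [B [ha hb hK]]]]] [J' [a' [b' [B' [ha' hb' hK']]]]].
exists (J * J')%type, (fun j z => a j.1 z * a' j.2 z),
  (fun j t => b j.1 t * b' j.2 t), (B * B').
split=> [j|j t Dt|z t Dt]; first exact: polyfunM.
  by rewrite normrM ler_pM ?hb ?hb'.
rewrite hK // hK' // big_distrlr pair_bigA /=.
by apply: eq_bigr => j _; rewrite mulrACA.
Qed.

Lemma separated_sum (I : Type) (s : seq I) (F : I -> 'cV[R]_d -> T -> R) :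
  (forall i, separated (F i)) -> separated (fun z t => \sum_(i <- s) F i z t).
Proof.
move=> hF; elim: s => [|i s IHs].
  under eq_fun do under eq_fun do rewrite big_nil.
  by apply: (@separated_polyfun (fun=> 0)); apply: polyfun_cst.
under eq_fun do under eq_fun do rewrite big_cons.
exact: separatedD.
Qed.

Lemma separated_prod (I : Type) (s : seq I) (P : pred I)
    (F : I -> 'cV[R]_d -> T -> R) :
  (forall i, separated (F i)) ->
  separated (fun z t => \prod_(i <- s | P i) F i z t).
Proof.
move=> hF; elim: s => [|i s IHs].
  under eq_fun do under eq_fun do rewrite big_nil.
  by apply: (@separated_polyfun (fun=> 1)); apply: polyfun_cst.
under eq_fun do under eq_fun do rewrite big_cons.
case: (P i) => //; exact: separatedM.
Qed.

End Kernels.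

(** * Averages over the group *)

Section Invariants.
Variables (R : realType) (d : nat) (G : {fset 'M[R]_d}) (GG : orthogonal_group G).

Definition orbit_sum (p : 'cV[R]_d -> R) x : R := \sum_(g <- G) p (g *m x).

(** Right translation by [h] permutes [G]. *)
Lemma orbit_sum_invariant p : invariant_map G (orbit_sum p).
Proof.
move=> h x hG; rewrite /orbit_sum; under eq_bigr do rewrite mulmxA.
rewrite -(big_map (fun g => g *m h) predT (fun g => p (g *m x))).
have uh : h \in unitmx by case/mulmx1_unit: (og_orthogonal GG hG).
apply: perm_big; apply: uniq_perm; rewrite ?fset_uniq //.
  rewrite map_inj_uniq ?fset_uniq // => g g' /(congr1 (mulmx^~ (invmx h))).
  by rewrite !mulmxK.
move=> g; apply/mapP/idP => [[g' g'G ->]|gG]; first exact: ogM.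
by exists (g *m invmx h); rewrite ?mulmxKV // ogM // ogV.
Qed.

Lemma polyfun_orbit_sum p : polyfun p -> polyfun (orbit_sum p).
Proof.
move=> hp; apply: polyfun_sum => g; apply: polyfun_comp hp => i.
exact: polyfun_mulmx.
Qed.

(** The average of each [K^~ t] is a combination of the averages of the [a j], with coefficients
    bounded independently of [t]. *)
Lemma separated_invariants T (D : T -> Prop) K : separated D K ->
  exists n (p : 'I_n -> 'cV[R]_d -> R) (C : R),
    [/\ forall i, polyfun (p i), forall i, invariant_map G (p i), 0 <= C &
     forall t x y s, D t -> 0 <= s -> (forall i, `|p i x - p i y| <= s) ->
       `|orbit_sum (K^~ t) x - orbit_sum (K^~ t) y| <= C * s].
Proof.
move=> [J [a [b [B [ha hb hK]]]]].
exists #|J|, (fun i => orbit_sum (a (enum_val i))), (#|J|%:R * `|B|).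
split=> [i|i||t x y s Dt s0 h].
- exact: polyfun_orbit_sum.
- exact: orbit_sum_invariant.
- exact: mulr_ge0.
have E z : orbit_sum (K^~ t) z = \sum_j orbit_sum (a j) z * b j t.
  rewrite /orbit_sum; under eq_bigr => g _ do rewrite hK //.
  by rewrite exchange_big; apply: eq_bigr => j _; rewrite mulr_suml.
rewrite !E -sumrB (le_trans (ler_norm_sum _ _ _)) //.
apply: (@le_trans _ _ (\sum_(j : J) `|B| * s)); last first.
  by rewrite sumr_const -[_ *+ _]mulr_natl mulrA.
apply: ler_sum => j _; rewrite -mulrBl normrM mulrC ler_pM //.
  exact: le_trans (hb _ _ Dt) (ler_norm _).
by have := h (enum_rank j); rewrite enum_rankK.
Qed.

Hypothesis free : acts_freely_on_sphere G.

(** A kernel vector of [g - 1%:M] would normalize to a fixed point on the sphere. The matrix is thus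
    invertible, and a bound on its inverse gives the constant. *)
Lemma free_displacement : exists2 k, 0 < k & forall g, g \in enum_fset G ->
  g != 1%:M -> forall y : 'cV[R]_d, sqn y = 1 -> k <= sqn (g *m y - y).
Proof.
apply: uniform_pos => [g k k' le h g1 y y1|g gG]; first exact: le_trans le (h g1 y y1).
have [->|g1] := eqVneq g 1%:M; first by exists 1.
have uM : g - 1%:M \in unitmx.
  apply/negPn/negP; rewrite -unitmx_tr unitmxE unitfE negbK => /det0P[v v0 hv].
  have w0 : v^T != 0 by rewrite -(inj_eq trmx_inj) trmxK trmx0.
  case/eqP: g1; apply: (free (x := (enorm v^T)^-1 *: v^T) gG).
    exact/usphereE/sqn_normalize.
  apply/eqP; rewrite -subr_eq0 -[X in _ - X]mul1mx -mulmxBl -scalemxAr.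
  by rewrite -[g - _]trmxK -trmx_mul hv trmx0 scaler0.
have [C C0 hC] := sqn_mulmx_le (invmx (g - 1%:M)).
exists C^-1; rewrite ?invr_gt0 // => _ y y1.
rewrite -[X in X <= _]mulr1 -y1 ler_pdivrMl //.
have -> : g *m y - y = (g - 1%:M) *m y by rewrite mulmxBl mul1mx.
by rewrite -{1}[y](mulKmx uM).
Qed.

End Invariants.

(** * Kernels that detect an orbit *)

Section OrbitKernel.
Variables (R : realType) (d : nat) (G : {fset 'M[R]_d}) (GG : orthogonal_group G).

Definition near_kernel (z y u : 'cV[R]_d) : R :=
  dot (z - y) u * \prod_(g <- G | g != 1%:M) sqn (z - g *m y).

Definition far_kernel (z y : 'cV[R]_d) : R := \prod_(g <- G) sqn (z - g *m y).

(** The boolean merges both kernels, so that one finite family of invariants serves for both. *)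
Definition orbit_kernel z (t : bool * 'cV[R]_d * 'cV[R]_d) : R :=
  if t.1.1 then near_kernel z t.1.2 t.2 else far_kernel z t.1.2.

Definition unit_params (t : bool * 'cV[R]_d * 'cV[R]_d) : Prop :=
  sqn t.1.2 = 1 /\ sqn t.2 = 1.

Lemma separated_orbit_kernel : separated unit_params orbit_kernel.
Proof.
have coord1 (x : 'cV[R]_d) j : sqn x = 1 -> `|x j 0| <= 1.
  by move=> /usphereE <-; apply: coord_le_enorm.
have sz i : separated unit_params (fun (z : 'cV[R]_d) _ => z i 0).
  by apply: separated_polyfun; apply: polyfun_coord.
have sy q : polyfun q -> separated unit_params (fun (_ : 'cV[R]_d) t => q t.1.2).
  move=> /(polyfun_lipschitz 1)[L L0 hL].
  (* The Lipschitz estimate between a point of the sphere and 0 bounds [q] there. *)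
  apply: (@separated_bounded _ _ _ _ _ (L * 1 + `|q 0|)) => t [hy _].
  rewrite -[q t.1.2](subrK (q 0)) (le_trans (ler_normD _ _)) // lerD2r.
  by apply: hL => // j; rewrite ?mxE ?subr0 ?normr0 //; apply: coord1.
have su i : separated unit_params (fun (_ : 'cV[R]_d) t => t.2 i 0).
  by apply: (@separated_bounded _ _ _ _ _ (1)) => t [_ hu]; apply: coord1.
have sb c : separated unit_params (fun (_ : 'cV[R]_d) t => (t.1.1 == c)%:R).
  apply: (@separated_bounded _ _ _ _ _ (1)) => t _.
  by rewrite ger0_norm ?ler0n // lern1 leq_b1.
have sd (g : 'M[R]_d) i : separated unit_params (fun z t => (z - g *m t.1.2) i 0).
  have -> : (fun z t => (z - g *m t.1.2) i 0) =
      fun z (t : bool * 'cV[R]_d * 'cV[R]_d) => z i 0 + -1 * (g *m t.1.2) i 0.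
    by apply/funext => z; apply/funext => t; rewrite !mxE mulN1r.
  apply: separatedD (sz i) (sy (fun y => -1 * (g *m y) i 0) _).
  by apply: polyfunM (polyfun_mulmx g i); apply: polyfun_cst.
have sq (g : 'M[R]_d) : separated unit_params (fun z t => sqn (z - g *m t.1.2)).
  rewrite /sqn; under eq_fun do under eq_fun do under eq_bigr do rewrite expr2.
  by apply: separated_sum => i; apply: separatedM.
(* Indicators replace the case distinction, and [1%:M *m] brings the linear factor under [sd]. *)
have -> : orbit_kernel = fun z t =>
    (t.1.1 == true)%:R * ((\sum_i (z - 1%:M *m t.1.2) i 0 * t.2 i 0) *
       \prod_(g <- G | g != 1%:M) sqn (z - g *m t.1.2)) +
    (t.1.1 == false)%:R * \prod_(g <- G) sqn (z - g *m t.1.2).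
  apply/funext => z; apply/funext => -[[b y] u] /=; rewrite mul1mx /orbit_kernel.
  by case: b; rewrite /= mul1r mul0r ?addr0 ?add0r.
apply: separatedD; apply: separatedM => //; last exact: separated_prod.
apply: separatedM; last exact: separated_prod.
by apply: separated_sum => i; apply: separatedM.
Qed.

Lemma far_kernel_ge0 z y : 0 <= far_kernel z y.
Proof. by apply: prodr_ge0 => g _; apply: sqn_ge0. Qed.

(** All terms are nonnegative and the identity term suffices: moving [g] to the other side bounds
    each of its factors below by [r]. *)
Lemma orbit_sum_far_kernel_ge x y (r : R) : 0 <= r ->
  (forall h, h \in G -> r <= sqn (h *m x - y)) ->
  r ^+ size (enum_fset G) <= orbit_sum G (far_kernel^~ y) x.
Proof.
move=> r0 h; rewrite /orbit_sum (bigD1_seq 1%:M) ?fset_uniq ?og1 //= mul1mx.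
rewrite (le_trans _ (_ : far_kernel x y <= _)) //; last first.
  by rewrite lerDl; apply: sumr_ge0 => g _; apply: far_kernel_ge0.
rewrite -(count_predT (enum_fset G)) -iter_mulr_1 -big_const_seq /far_kernel.
rewrite big_seq [X in _ <= X]big_seq; apply: ler_prod => g gG; rewrite r0.
have og := og_orthogonal GG gG.
have ug : g \in unitmx by case/mulmx1_unit: og.
apply: le_trans (h (invmx g) (ogV GG gG)) _.
rewrite -(sqn_orthogonal (invmx g *m x - y) og) mulmxBr mulmxA mulmxV //.
by rewrite mul1mx lexx.
Qed.

Lemma orbit_sum_far_kernel_eq0 y : orbit_sum G (far_kernel^~ y) y = 0.
Proof.
rewrite /orbit_sum big_seq big1 // => g gG.
by rewrite /far_kernel (bigD1_seq g) ?fset_uniq //= subrr sqn0 mul0r.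
Qed.

Lemma orbit_sum_near_kernel_eq0 y u :
  orbit_sum G (fun z => near_kernel z y u) y = 0.
Proof.
rewrite /orbit_sum big_seq big1 // => g gG; rewrite /near_kernel.
have [->|g1] := eqVneq g 1%:M.
  by rewrite mul1mx subrr dot0l mul0r.
rewrite -big_filter (bigD1_seq g) ?mem_filter ?g1 ?filter_uniq ?fset_uniq //=.
by rewrite subrr sqn0 mul0r mulr0.
Qed.

(* The term of the identity is of order [sqn (x - y)], every other one contains
   the factor [sqn (h *m x - h *m y)] and is of second order in [x - y]. *)
Lemma orbit_sum_near_kernel_ge (k : R) x y (u := (enorm (x - y))^-1 *: (x - y)) :
  (forall g, g \in enum_fset G -> g != 1%:M -> k <= sqn (g *m y - y)) ->
  0 < k -> sqn x = 1 -> sqn y = 1 -> x != y -> sqn (x - y) <= k / 4 ->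
  enorm (x - y) * (\prod_(g <- G | g != 1%:M) (k / 4)) -
     (size (enum_fset G))%:R * (5 / 2 * 4 ^+ size (enum_fset G)) * sqn (x - y)
  <= orbit_sum G (fun z => near_kernel z y u) x.
Proof.
move=> hk k0 x1 y1 xy dk; set m := size _; set d2 := sqn (x - y).
have sqn4 h g : h \in G -> g \in G -> 0 <= sqn (h *m x - g *m y) <= 4.
  move=> hG gG; rewrite sqn_ge0 (le_trans (sqnD_le _ _)) // sqnN.
  rewrite (sqn_orthogonal x (og_orthogonal GG hG)).
  by rewrite (sqn_orthogonal y (og_orthogonal GG gG)) x1 y1; lra.
have oG : 1%:M \in G := og1 GG.
rewrite /orbit_sum (bigD1_seq 1%:M) ?fset_uniq //= mul1mx; apply: lerD.
  rewrite /near_kernel /u dotC dotZl -sqnE -sqr_enorm expr2 mulKf; last first.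
    by rewrite -sqrf_eq0 sqr_enorm sqn_eq0 subr_eq0.
  rewrite ler_wpM2l ?enorm_ge0 // big_seq_cond [X in _ <= X]big_seq_cond.
  apply: ler_prod => g /andP[gG g1]; rewrite divr_ge0 ?(ltW k0) //=.
  (* This bounds [k] by [2 * sqn (x - g *m y) + 2 * sqn (x - y)], whose last term is at most
     [k / 2]. *)
  have := sqnD_le (g *m y - x) (x - y); rewrite addrA subrK -[g *m y - x]opprB sqnN.
  have := hk g gG g1; move: dk; lra.
rewrite lerNl -sumrN.
apply: (@le_trans _ _ (\sum_(h <- G) 5 / 2 * 4 ^+ m * d2)); last first.
  by rewrite big_const_seq count_predT iter_addr_0 -[_ *+ _]mulr_natl
    -[X in _ <= X]mulrA lexx.
have c0 : 0 <= 5 / 2 * 4 ^+ m * d2 by rewrite !mulr_ge0 ?exprn_ge0 ?sqn_ge0 //; lra.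
rewrite big_mkcond big_seq [X in _ <= X]big_seq; apply: ler_sum => h hG.
case: ifP => // h1; rewrite (le_trans (ler_norm _)) // normrN normrM -mulrA.
rewrite ler_pM //.
  (* The constant [5 / 2] is [(4 + 1) / 2]: a squared distance of at most 4 and a unit vector. *)
  rewrite (le_trans (dot_le _ _)) // sqn_normalize ?subr_eq0 //.
  by have /andP[_] := sqn4 h 1%:M hG oG; rewrite mul1mx; lra.
rewrite -big_filter (bigD1_seq h) ?mem_filter ?h1 ?filter_uniq ?fset_uniq //=.
rewrite -mulmxBr (sqn_orthogonal _ (og_orthogonal GG hG)) -/d2 mulrC normrM.
rewrite [X in _ * X]ger0_norm ?sqn_ge0 // ler_wpM2r ?sqn_ge0 // big_filter_cond.
have /andP[p0 p4] :=
  prod_itv4 (fun g => (g != 1%:M) && (g != h)) (sqn4 h ^~ hG).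
by rewrite ger0_norm.
Qed.

Hypothesis free : acts_freely_on_sphere G.

(** Up to distance [r] the first-order term of the near kernel dominates; beyond [r] the far kernel
    is bounded below, while distances are at most 2. *)
Lemma orbit_kernel_gap : exists2 c, 0 < c & forall x y,
  sqn x = 1 -> sqn y = 1 -> x != y ->
  (forall h, h \in G -> sqn (x - y) <= sqn (h *m x - y)) ->
  exists2 t, unit_params t &
    c * enorm (x - y) <=
      orbit_sum G (orbit_kernel^~ t) x - orbit_sum G (orbit_kernel^~ t) y.
Proof.
have [k k0 hk] := free_displacement free.
pose m := size (enum_fset G).
pose c1 := \prod_(g <- G | g != 1%:M) (k / 4).
pose C := m%:R * (5 / 2 * 4 ^+ m) : R.
have k4 : 0 < k / 4 by lra.
have c10 : 0 < c1 by apply: prodr_gt0.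
have C0 : 0 <= C by rewrite !mulr_ge0 ?exprn_ge0 //; lra.
(* The bound 1 gives [sqn (x - y) <= enorm (x - y)], the second puts this below [k / 4], and the
   third leaves at least half of [c1] after subtracting [C * r]. *)
pose r := Num.min 1 (Num.min (k / 4) (c1 / (2 * (C + 1)))).
have r0 : 0 < r.
  by rewrite !lt_min ltr01 k4 divr_gt0 // mulr_gt0 //; lra.
have r1 : r <= 1 by rewrite ge_min lexx.
have rk : r <= k / 4 by rewrite !ge_min lexx orbT.
have rC : r <= c1 / (2 * (C + 1)) by rewrite !ge_min lexx !orbT.
exists (Num.min (c1 / 2) ((r ^+ 2) ^+ m / 2)).
  by rewrite lt_min !divr_gt0 ?exprn_gt0.
move=> x y x1 y1 xy hmin; have e0 := enorm_ge0 (x - y).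
have [le_r|lt_r] := leP (enorm (x - y)) r.
  exists (true, y, (enorm (x - y))^-1 *: (x - y)).
    by split=> //=; rewrite sqn_normalize // subr_eq0.
  rewrite /orbit_kernel /= orbit_sum_near_kernel_eq0 subr0.
  have h2 : sqn (x - y) <= k / 4.
    rewrite -sqr_enorm (le_trans _ rk) // expr2 (le_trans _ le_r) //.
    by rewrite ler_piMr // (le_trans le_r).
  apply: le_trans
    (orbit_sum_near_kernel_ge (fun g gG g1 => hk g gG g1 y y1) k0 x1 y1 xy h2).
  rewrite -/c1 -/m -/C -sqr_enorm expr2 mulrA [_ * c1]mulrC -mulrBl ler_wpM2r //.
  rewrite ge_min; apply/orP; left.
  have : C * enorm (x - y) <= C * r by rewrite ler_wpM2l.
  have : r * (2 * (C + 1)) <= c1 by rewrite -ler_pdivlMr // mulr_gt0 //; lra.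
  by move: r0; lra.
exists (false, y, y) => //; rewrite /orbit_kernel /= orbit_sum_far_kernel_eq0 subr0.
apply: le_trans (@orbit_sum_far_kernel_ge x y (r ^+ 2) (sqr_ge0 _) _); last first.
  move=> h /hmin; apply: le_trans; rewrite -sqr_enorm lerXn2r ?nnegrE // ltW //.
have e2 : enorm (x - y) <= 2.
  rewrite -(ler_pXn2r (isT : (0 < 2)%N)) ?nnegrE // sqr_enorm.
  by rewrite (le_trans (sqnD_le _ _)) // sqnN x1 y1; lra.
have rm0 : 0 <= (r ^+ 2) ^+ m by rewrite !exprn_ge0 // ltW.
rewrite (@le_trans _ _ ((r ^+ 2) ^+ m / 2 * enorm (x - y))) //.
  by rewrite ler_wpM2r // ge_min lexx orbT.
by have := ler_wpM2l rm0 e2; rewrite mulrAC; lra.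
Qed.

End OrbitKernel.

(** * Reduction to dimension 2d - 1 *)

(** Only the lower Lipschitz bound is recorded, with [s] in the role of the sup norm of the
    difference; on the sphere every polynomial satisfies an upper one. *)
Definition separating_invariants (R : realType) d (G : {fset 'M[R]_d}) n : Prop :=
  exists (p : 'I_n -> 'cV[R]_d -> R) (c : R),
  [/\ forall i, polyfun (p i), forall i, invariant_map G (p i), 0 < c &
      forall x y s, sqn x = 1 -> sqn y = 1 -> 0 <= s ->
        (forall i, `|p i x - p i y| <= s) -> c * orbit_min_dist G x y <= s].

(** The gap is applied at the point [g *m x] of the orbit nearest to [y]; invariance brings the
    values back to [x]. *)
Lemma free_separating_invariants (R : realType) d (G : {fset 'M[R]_d}) :
  orthogonal_group G -> acts_freely_on_sphere G ->
  exists n, separating_invariants G n.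
Proof.
move=> GG free.
have [n [p [C [hp ip C0 hC]]]] := separated_invariants GG (separated_orbit_kernel G).
have [c c0 hc] := orbit_kernel_gap GG free.
exists n, p, (c / (C + 1)); split=> //; first by rewrite divr_gt0 // ltr_wpDl.
move=> x y s x1 y1 s0 hs.
have [[g gG e] hmin] := orbit_min_distP GG x y; rewrite e /edist.
have [->|ne] := eqVneq (g *m x) y.
  by rewrite subrr /enorm -[X in Num.sqrt X]/(sqn 0) sqn0 sqrtr0 mulr0.
have [|h hG|t Dt] := hc (g *m x) y _ y1 ne.
- by rewrite (sqn_orthogonal _ (og_orthogonal GG gG)).
- rewrite mulmxA -!sqr_enorm lerXn2r ?nnegrE ?enorm_ge0 //.
  by have := hmin _ (ogM GG hG gG); rewrite e.
rewrite (orbit_sum_invariant GG _ _ gG) => /le_trans le.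
rewrite mulrAC ler_pdivrMr ?ltr_wpDl // le //.
rewrite (le_trans (ler_norm _)) // (le_trans (hC _ _ _ _ Dt s0 hs)) //.
by rewrite mulrC ler_wpM2l // lerDl.
Qed.

Lemma separating_invariantsS (R : realType) d (G : {fset 'M[R]_d}) n :
  separating_invariants G n -> separating_invariants G n.+1.
Proof.
move=> [p [c [hp ip c0 hc]]].
exists (fun i x => if unlift ord_max i is Some j then p j x else 0), c.
split=> // [i|i g x gG|x y s x1 y1 s0 h].
- by case: unliftP => [j _|_]; [apply: hp | apply: polyfun_cst].
- by case: unliftP => [j _|//]; apply: ip.
- by apply: hc => // j; have := h (lift ord_max j); rewrite liftK.
Qed.

Lemma separating_invariants_pred (R : realType) d (G : {fset 'M[R]_d.+1}) n :
  (2 * d < n)%N -> separating_invariants G n.+1 -> separating_invariants G n.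
Proof.
move=> ltn [p [c [hp ip c0 hc]]].
have [a [c' [c'0 hc']]] := secant_projection hp ltn.
exists (fun i x => p (lift ord_max i) x - a i * p ord_max x), (c * c').
split=> [i|i g x gG||x y s x1 y1 s0 h].
- under eq_fun do rewrite -mulNr.
  apply: polyfunD (hp _) _; apply: polyfunM (hp _); exact: polyfun_cst.
- by rewrite !ip.
- exact: mulr_gt0.
rewrite mulrAC -ler_pdivlMr //; apply: hc => // [|i]; first by rewrite divr_ge0 // ltW.
by rewrite ler_pdivlMr // mulrC; apply: hc' h i.
Qed.

(** In dimension [d.+1] the target [2 * d.+1 - 1] is [(2 * d).+1]. Small families are padded with
    zeros, large ones projected one coordinate at a time. *)
Lemma separating_invariants_2d (R : realType) d (G : {fset 'M[R]_d.+1}) n :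
  separating_invariants G n -> separating_invariants G (2 * d).+1.
Proof.
have [le|/ltnW le] := leqP n (2 * d).+1.
  rewrite -(subnK le); elim: (_ - n)%N => // k IHk /IHk; exact: separating_invariantsS.
rewrite -(subnK le); elim: (n - _)%N => // k IHk; rewrite addSn.
move=> /separating_invariants_pred h; apply/IHk/h.
by rewrite addnS ltnS leq_addl.
Qed.

Lemma enorm_le_sum (R : realType) n (v : 'cV[R]_n) : enorm v <= \sum_i `|v i 0|.
Proof.
have S0 : 0 <= \sum_i `|v i 0| by apply: sumr_ge0.
rewrite -(ler_pXn2r (isT : (0 < 2)%N)) ?nnegrE ?enorm_ge0 // sqr_enorm.
rewrite expr2 mulr_suml; apply: ler_sum => i _.
rewrite -real_normK ?num_real // expr2 ler_wpM2l // (bigD1 i) //= lerDl.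
exact: sumr_ge0.
Qed.

(** The upper bound is the Lipschitz estimate on the cube around the sphere, applied at the point of
    the orbit of [x] nearest to [y]. *)
Lemma separating_invariants_bilipschitz (R : realType) d (G : {fset 'M[R]_d}) n :
  orthogonal_group G -> separating_invariants G n -> has_bilipschitz_polynomial_map G n.
Proof.
move=> GG [p [c [hp ip c0 hc]]].
pose f (x : 'cV[R]_d) : 'cV[R]_n := \col_i p i x.
exists (fun X => f (val (orbit_repr X))); split.
  exists f; split=> [|g x gG|x].
  - have [P hP] := choice hp.
    by exists P => x i; rewrite mxE hP.
  - by apply/colP => i; rewrite !mxE ip.
  - have [g gG ->] := orbit_class_eq GG (orbit_reprK (orbit_class G x)).
    by apply/colP => i; rewrite !mxE ip.
have /choice[L hL] i : exists L, forall (x y : 'cV[R]_d) s,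
    (forall j, `|x j 0| <= 1) -> (forall j, `|y j 0| <= 1) ->
    (forall j, `|x j 0 - y j 0| <= s) -> 0 <= s -> `|p i x - p i y| <= L * s.
  by have [L _ hL] := polyfun_lipschitz 1 (hp i); exists L.
exists c, (Num.max c (\sum_i L i)); split=> //; first by rewrite le_max lexx.
move=> X Y; rewrite /qdist; set x := val (orbit_repr X); set y := val (orbit_repr Y).
have x1 : sqn x = 1 by apply/usphereE;
  apply: classical_sets.set_mem (valP (orbit_repr X)).
have y1 : sqn y = 1 by apply/usphereE;
  apply: classical_sets.set_mem (valP (orbit_repr Y)).
apply/andP; split.
  apply: hc => // [|i]; first exact: enorm_ge0.
  by have := coord_le_enorm (f x - f y) i; rewrite !mxE.
have [[g gG ->] _] := orbit_min_distP GG x y.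
apply: (@le_trans _ _ ((\sum_i L i) * edist (g *m x) y)); last first.
  by rewrite ler_wpM2r ?enorm_ge0 // le_max lexx orbT.
rewrite (le_trans (enorm_le_sum _)) // mulr_suml; apply: ler_sum => i _.
rewrite !mxE -(ip i g x gG); apply: hL => [j|j|j|].
- rewrite (le_trans (coord_le_enorm _ _)) //.
  by rewrite (enorm_orthogonal _ (og_orthogonal GG gG)) ((usphereE x).2 x1).
- by rewrite (le_trans (coord_le_enorm _ _)) // ((usphereE y).2 y1).
- by have := coord_le_enorm (g *m x - y) j; rewrite !mxE.
- exact: enorm_ge0.
Qed.

(** * Bilipschitz invariants force freeness *)

Lemma dot_le_enorm (R : realType) d (v y : 'cV[R]_d) :
  `|dot v y| <= (\sum_i `|v i 0|) * enorm y.
Proof.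
rewrite (le_trans (ler_norm_sum _ _ _)) // mulr_suml; apply: ler_sum => i _.
by rewrite normrM ler_wpM2l // coord_le_enorm.
Qed.

(** [v] is the gradient at [x]. The product case is the Leibniz rule, the product of the two
    increments going into the quadratic error. *)
Lemma polyfun_taylor (R : realType) d (p : 'cV[R]_d -> R) (x : 'cV[R]_d) :
  polyfun p -> exists (v : 'cV[R]_d) (C : R), 0 <= C /\
    forall y : 'cV[R]_d, sqn y <= 1 ->
    `|p (x + y) - p x - dot v y| <= C * sqn y.
Proof.
elim/polyfun_ind => [c|j|q r|q r].
- exists 0, 0; split=> // y _.
  by rewrite subrr sub0r normrN dot0l mul0r normr0.
- exists (\col_i (i == j)%:R), 0; split=> // y _.
  rewrite /dot (bigD1 j) //= big1 => [|i /negPf ij]; last by rewrite mxE ij mul0r.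
  by rewrite !mxE eqxx mul1r addr0 mul0r [x j 0 + _]addrC addrK subrr normr0.
- move=> [v [C [C0 hv]]] [v' [C' [C'0 hv']]].
  exists (v + v'), (C + C'); split=> [|y y1]; first exact: addr_ge0.
  rewrite mulrDl dotDl; apply: le_trans (lerD (hv y y1) (hv' y y1)).
  rewrite (le_trans _ (ler_normD _ _)) // le_eqVlt; apply/orP; left.
  by apply/eqP; congr (`|_|); ring.
move=> [v [C [C0 hv]]] [v' [C' [C'0 hv']]].
pose S (u : 'cV[R]_d) := \sum_i `|u i 0|.
have S0 u : 0 <= S u by apply: sumr_ge0.
(* On the unit ball [sqn y <= enorm y], so increments are at most linear. *)
have lin (s : 'cV[R]_d -> R) u B (y : 'cV[R]_d) : 0 <= B -> sqn y <= 1 ->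
    `|s (x + y) - s x - dot u y| <= B * sqn y ->
    `|s (x + y) - s x| <= (B + S u) * enorm y.
  move=> B0 y1 h; rewrite -[s (x + y) - s x](subrK (dot u y)) mulrDl.
  rewrite (le_trans (ler_normD _ _)) // lerD ?dot_le_enorm // (le_trans h) //.
  rewrite ler_wpM2l // -sqr_enorm expr2 ler_piMl ?enorm_ge0 //.
  by rewrite -(ler_pXn2r (isT : (0 < 2)%N)) ?nnegrE ?enorm_ge0 // sqr_enorm expr1n.
exists (q x *: v' + r x *: v), ((C + S v) * (C' + S v') + `|q x| * C' + `|r x| * C).
split=> [|y y1]; first by rewrite !addr_ge0 ?mulr_ge0 ?addr_ge0.
have -> : q (x + y) * r (x + y) - q x * r x - dot (q x *: v' + r x *: v) y =
    (q (x + y) - q x) * (r (x + y) - r x) + q x * (r (x + y) - r x - dot v' y) +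
    r x * (q (x + y) - q x - dot v y).
  by rewrite dotDl !dotZl; ring.
rewrite [leRHS]mulrDl [X in _ <= X + _]mulrDl (le_trans (ler_normD _ _)) // lerD //.
  rewrite (le_trans (ler_normD _ _)) // lerD // normrM; last first.
    by rewrite -mulrA ler_wpM2l ?hv'.
  rewrite -sqr_enorm expr2.
  have h := ler_pM (normr_ge0 _) (normr_ge0 _) (lin q v C y C0 y1 (hv y y1))
    (lin r v' C' y C'0 y1 (hv' y y1)).
  by rewrite (le_trans h) // mulrACA mulrA.
by rewrite normrM -mulrA ler_wpM2l ?hv.
Qed.

Lemma le0_of_le_small (R : realFieldType) (a K r : R) : 0 < r ->
  (forall t, 0 < t -> t <= r -> a <= K * t) -> a <= 0.
Proof.
move=> r0 h; rewrite leNgt; apply/negP => a0.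
have K1 : 0 < `|K| + 1 by rewrite ltr_wpDl.
(* This choice makes [K * t] at most [a / 2]. *)
pose t := Num.min r (a / (2 * (`|K| + 1))).
have t0 : 0 < t by rewrite lt_min r0 divr_gt0 // mulr_gt0.
have tr : t <= r by rewrite ge_min lexx.
have := h t t0 tr.
have : t * (2 * (`|K| + 1)) <= a.
  by rewrite -ler_pdivlMr ?mulr_gt0 // ge_min lexx orbT.
have : K * t <= `|K| * t by rewrite ler_wpM2r ?ler_norm // ltW.
by nra.
Qed.

Lemma dot_orthogonal (R : realType) d (g : 'M[R]_d) (x y : 'cV[R]_d) :
  orthogonal_mx g -> dot (g *m x) (g *m y) = dot x y.
Proof.
move=> og; have := sqn_orthogonal (x + y) og.
by rewrite mulmxDr !sqnD !(sqn_orthogonal _ og); lra.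
Qed.

(** As [g] fixes [x], it sends [x + t *: w] to [x + t *: (g *m w)]. The values of [p] there agree,
    so the first-order terms agree up to order [t^2]. *)
Lemma invariant_gradient (R : realType) d (p : 'cV[R]_d -> R) (g : 'M[R]_d)
    (x u w : 'cV[R]_d) (C : R) : orthogonal_mx g ->
  (forall y, p (g *m y) = p y) -> g *m x = x -> 0 <= C ->
  (forall y, sqn y <= 1 -> `|p (x + y) - p x - dot u y| <= C * sqn y) ->
  dot u (w - g *m w) = 0.
Proof.
move=> og hp gx C0 hu; apply/eqP; rewrite -normr_le0.
have q0 : 0 < 1 + sqn w by rewrite ltr_pwDl // sqn_ge0.
apply: (@le0_of_le_small _ _ (2 * C * sqn w) (1 + sqn w)^-1); first by rewrite invr_gt0.
move=> t t0 tr; have tw : sqn (t *: w) <= 1.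
  have : t * (1 + sqn w) <= 1 by rewrite -ler_pdivlMr // mul1r.
  by have := sqn_ge0 w; rewrite sqnZ; nra.
have tgw : sqn (t *: (g *m w)) = sqn (t *: w) by rewrite scalemxAr sqn_orthogonal.
rewrite -(ler_pM2l t0) -{1}(gtr0_norm t0) -normrM.
have -> : t * dot u (w - g *m w) =
    (p (x + t *: (g *m w)) - p x - dot u (t *: (g *m w))) -
    (p (x + t *: w) - p x - dot u (t *: w)).
  have -> : p (x + t *: (g *m w)) = p (x + t *: w).
    by rewrite -{1}gx scalemxAr -mulmxDr hp.
  rewrite ![dot u _]dotC dotDl dotNl !dotZl; ring.
rewrite (le_trans (ler_normB _ _)) // (le_trans (lerD (hu _ _) (hu _ tw))) ?tgw //.
by rewrite sqnZ; nra.
Qed.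

Lemma bilipschitz_free (R : realType) d (G : {fset 'M[R]_d}) n :
  orthogonal_group G -> has_bilipschitz_polynomial_map G n -> acts_freely_on_sphere G.
Proof.
move=> GG [h [[f [[P hP] fG hf]] [al [be [al0 _ hal]]]]] g x gG x1 gx.
have og := og_orthogonal GG gG.
apply/eqP/negPn/negP => g1.
have [w0 hw0] : exists w : 'cV[R]_d, w - g *m w != 0.
  apply/not_existsP => hw; case/eqP: g1; apply/matrixP => i j.
  have /negP := hw (delta_mx j 0); rewrite negbK subr_eq0 -colE => /eqP/colP/(_ i).
  by rewrite !mxE eqxx andbT.
pose w := (enorm (w0 - g *m w0))^-1 *: w0; pose v := w - g *m w.
have v1 : sqn v = 1 by rewrite /v /w -scalemxAr -scalerBr sqn_normalize.
(* [g] preserves inner products and fixes [x], so [w] and [g *m w] have the same component along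
   [x]. *)
have xv : dot x v = 0.
  by rewrite dotC dotDl dotNl -[in X in _ - X]gx dot_orthogonal // subrr.
have sx1 : sqn x = 1 by apply/usphereE.
(* [x + y] is the rational parametrization [((1 - t^2) x + 2 t v) / (1 + t^2)] of the great circle
   through [x] and [v]. *)
have /choice[K hK] i : exists K, forall y t, 0 < t -> t <= 1 / 2 ->
    y = (1 + t ^+ 2)^-1 *: ((- (2 * t ^+ 2)) *: x + (2 * t) *: v) ->
    sqn y <= 4 * t ^+ 2 ->
    `|f (x + y) i 0 - f x i 0| <= K * t ^+ 2.
  have hp : polyfun (fun x => f x i 0) by exists (P i) => z; exact: hP.
  have [u [C [C0 hu]]] := polyfun_taylor x hp.
  have uv : dot u v = 0.
    apply: (@invariant_gradient _ _ (fun x => f x i 0) g x u w C og) => // y.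
    by rewrite fG.
  (* Since [u] is orthogonal to [v], [dot u y] only sees the component of [y] along [x], which is of
     order [t^2]. *)
  exists (2 * `|dot u x| + 4 * C) => y t t0 t2 ey hy.
  rewrite -[_ - _](subrK (dot u y)) (le_trans (ler_normD _ _)) // addrC mulrDl lerD //.
    rewrite ey dotC dotZl dotDl !dotZl [dot v u]dotC uv mulr0 addr0 dotC.
    have q1 : 1 <= 1 + t ^+ 2 by rewrite lerDl sqr_ge0.
    rewrite normrM ger0_norm ?invr_ge0 ?(le_trans ler01) //.
    rewrite ler_pdivrMl ?(lt_le_trans ltr01) //.
    have t20 : 0 <= 2 * t ^+ 2 by rewrite mulr_ge0 // sqr_ge0.
    rewrite normrM normrN (ger0_norm t20) [2 * t ^+ 2 * _]mulrAC.
    by rewrite ler_peMl //; apply: mulr_ge0; [apply: mulr_ge0 | apply: sqr_ge0].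
  rewrite (le_trans (hu y _)) //; first by rewrite (le_trans hy) //; nra.
  by rewrite -mulrA mulrCA ler_wpM2l.
(* Elements that move [x] move it by a fixed amount, so for small [t] they cannot bring [x + y]
   close to [x]. *)
have [k k0 hk] : exists2 k, 0 < k & forall a, a \in enum_fset G ->
    a *m x != x -> k <= sqn (a *m x - x).
  apply: uniform_pos => [a k k' le hk ax|a aG]; first exact: le_trans le (hk ax).
  have [->|ax] := eqVneq (a *m x) x; first by exists 1.
  by exists (sqn (a *m x - x)) => //; rewrite lt_def sqn_ge0 sqn_eq0 subr_eq0 ax.
suff : al <= 0 by rewrite leNgt al0.
apply: (@le0_of_le_small _ _ (\sum_i K i) (Num.min (1 / 2) (k / 12))).
  by rewrite lt_min !divr_gt0.
move=> t t0; rewrite le_min => /andP[t2 tk].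
pose y := (1 + t ^+ 2)^-1 *: ((- (2 * t ^+ 2)) *: x + (2 * t) *: v).
have qp : 0 < 1 + t ^+ 2 by rewrite ltr_pwDl // sqr_ge0.
have q0 : 1 + t ^+ 2 != 0 by rewrite gt_eqF.
have t2' : t ^+ 2 <= 1 by nra.
have tt : t ^+ 2 * t ^+ 2 <= t ^+ 2 by rewrite ler_piMl ?sqr_ge0.
have tt0 : 0 <= t ^+ 2 * t ^+ 2 by rewrite mulr_ge0 ?sqr_ge0.
have ey : sqn y = 4 * t ^+ 2 / (1 + t ^+ 2).
  rewrite /y sqnZ sqnD !sqnZ dotZl dotC dotZl [dot v x]dotC xv sx1 v1.
  by field.
have y4 : sqn y <= 4 * t ^+ 2.
  by rewrite ey ler_pdivrMr // mulrDr mulr1 -mulrA; lra.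
have y2 : 2 * t ^+ 2 <= sqn y.
  by rewrite ey ler_pdivlMr // mulrDr mulr1 -mulrA; lra.
have xy1 : usphere R d (x + y).
  apply/usphereE; rewrite sqnD sx1 ey dotC dotZl dotDl !dotZl -sqnE sx1 dotC xv.
  by field.
have := hal (orbit_class G (classical_sets.SigSub (classical_sets.mem_set xy1)))
  (orbit_class G (classical_sets.SigSub (classical_sets.mem_set x1))).
rewrite (qdist_class GG) !hf /= => /andP[le _].
have [[a aG e] _] := orbit_min_distP GG (x + y) x.
have oa := og_orthogonal GG aG.
have : t <= orbit_min_dist G (x + y) x.
  rewrite e -(ler_pXn2r (isT : (0 < 2)%N)) ?nnegrE ?enorm_ge0 ?(ltW t0) // sqr_enorm.
  (* If [a] fixes [x], the squared distance is [sqn y >= 2 * t ^+ 2]. Otherwise it is at least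
     [k / 2 - 4 * t ^+ 2], and [t <= 1 / 2] with [t <= k / 12] gives [t ^+ 2 <= k / 24]. *)
  have [ax|ax] := eqVneq (a *m x) x.
    rewrite mulmxDr ax addrAC subrr add0r sqn_orthogonal //.
    by move: y2; have := sqr_ge0 t; lra.
  have := sqnD_le (a *m (x + y) - x) (- (a *m y)).
  rewrite sqnN (sqn_orthogonal _ oa) mulmxDr [a *m x + _ - x]addrAC addrK.
  have := hk a aG ax; have : t ^+ 2 <= k / 24 by nra.
  by lra.
move=> /(ler_wpM2l (ltW al0))/le_trans/(_ le) le'.
(* After multiplication by [t], the linear lower bound [al * t] meets the quadratic increments of
   [f]. *)
rewrite -(ler_pM2r t0) -mulrA -expr2 (le_trans le') //.
rewrite (le_trans (enorm_le_sum _)) // mulr_suml; apply: ler_sum => i _.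
by rewrite !mxE; apply: hK y4.
Qed.

Theorem theorem25 (R : realType) (d : nat) (hd : (0 < d)%N)
    (G : {fset 'M[R]_d}) (hG : orthogonal_group G) :
  [<-> acts_freely_on_sphere G ;
       exists2 n : nat, (0 < n)%N & has_bilipschitz_polynomial_map G n ;
       has_bilipschitz_polynomial_map G (2 * d - 1) ].
Proof.
have free_bilip : acts_freely_on_sphere G ->
    has_bilipschitz_polynomial_map G (2 * d - 1).
  case: d hd G hG => // d _ G hG free.
  have [n /separating_invariants_2d sepG] := free_separating_invariants hG free.
  rewrite mulnS add2n subn1; exact: separating_invariants_bilipschitz sepG.
tfae.
- by move=> /free_bilip; exists (2 * d - 1)%N; rewrite // subn_gt0 leq_pmulr.
- by move=> [n _ /(bilipschitz_free hG)/free_bilip].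
- exact: bilipschitz_free.
Qed.
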